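(* Let $\mathbb{F}$ be an infinite field with $\mathrm{char}\,\mathbb{F}\neq 2$, let $V$ be a finite-dimensional vector space over $\mathbb{F}$, and let $\mathrm{G}=\mathrm{GL}(V)$ act on the right on the space $\mathfrak{Q}$ of quadratic forms on $V$ by $(Q\mathbf{g})(\mathbf{u})=Q(\mathbf{g}\mathbf{u})$. If $Q\in\mathfrak{Q}$ is a quadratic form of rank $r$, then the Zariski closure $\overline{Q\mathrm{G}}$ of the orbit $Q\mathrm{G}$ in $\mathfrak{Q}$ is $\mathfrak{Q}_{r}$, the set of all quadratic forms on $V$ of rank at most $r$.
   Context: For a quadratic form $Q$ on $V$, $B_Q$ denotes the corresponding symmetric bilinear form, $B_Q(\mathbf{u},\mathbf{v})=\frac14\left(Q(\mathbf{u}+\mathbf{v})-Q(\mathbf{u}-\mathbf{v})\right)$, so that $Q(\mathbf{u})=B_Q(\mathbf{u},\mathbf{u})$. Relative to a basis $\mathbf{v}_1,\ldots,\mathbf{v}_n$ of $V$, $[B_Q]$ is the symmetric matrix with entries $B_Q(\mathbf{v}_i,\mathbf{v}_j)$, and the rank of $Q$ is the rank of $[B_Q]$. The space $\mathfrak{Q}$ is a finite-dimensional $\mathbb{F}$-vector space with coordinates the entries $b_{ij}$, $i\le j$, of $[B_Q]$. The Zariski closure of a subset $S\subseteq\mathfrak{Q}$ is the set of all $Q'\in\mathfrak{Q}$ at which every polynomial in the $b_{ij}$ (with coefficients in $\mathbb{F}$) that vanishes on $S$ also vanishes. *)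

(* Defs.v *)
From HB Require Import structures.
From mathcomp Require Import all_boot all_order all_algebra.
From mathcomp Require Import boolp classical_sets cardinality.
From mathcomp Require Import mpoly.

Set Implicit Arguments.
Unset Strict Implicit.
Unset Printing Implicit Defensive.

Import GRing.Theory.

Local Open Scope classical_set_scope.
Local Open Scope ring_scope.

Section QuadraticForms.
Variables (F : fieldType) (V : vectType F).

(* In characteristic 2 the inverse of 4 is 0, so this is meaningful only when
   2 is invertible in F. *)
Definition assoc_bilin (q : V -> F) (u v : V) : F :=
  4%:R^-1 * (q (u + v) - q (u - v)).

(* The two scaling operators *%R say that assoc_bilin is F-linear in each of
   its arguments. *)
Record quadratic_form := QuadraticForm {
  qf_fun :> V -> F;
  qf_homog : forall (a : F) (u : V), qf_fun (a *: u) = a ^+ 2 * qf_fun u;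
  qf_bilin : bilinear_for *%R *%R (assoc_bilin qf_fun)
}.

Lemma quadratic_form_ext (P Q : quadratic_form) : P =1 Q -> P = Q.
Proof.
case: P Q => [p hp bp] [q hq bq] /= /funext pq.
by case: _ / pq in hq bq *; congr QuadraticForm; apply: Prop_irrelevance.
Qed.

Definition GL : set 'End(V) := [set g | bijective g].

Fact qf_act_homog (Q : quadratic_form) (g : 'End(V)) (a : F) (u : V) :
  Q (g (a *: u)) = a ^+ 2 * Q (g u).
Proof. by rewrite linearZ qf_homog. Qed.

Fact qf_act_bilin (Q : quadratic_form) (g : 'End(V)) :
  bilinear_for *%R *%R (assoc_bilin (fun u => Q (g u))).
Proof.
have E u v : assoc_bilin (fun u => Q (g u)) u v = assoc_bilin Q (g u) (g v).
  by rewrite /assoc_bilin linearD linearB.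
have [Hl Hr] := qf_bilin Q.
by split=> w a u v /=; rewrite !E linearP; [apply: Hl | apply: Hr].
Qed.

Definition qf_act (Q : quadratic_form) (g : 'End(V)) : quadratic_form :=
  QuadraticForm (qf_act_homog Q g) (qf_act_bilin Q g).

Definition orbit_GL (Q : quadratic_form) : set quadratic_form :=
  [set qf_act Q g | g in GL].

Section Coordinates.
Variables (n : nat) (e : n.-tuple V).

Definition gram_mx (Q : quadratic_form) : 'M[F]_n :=
  \matrix_(i, j) assoc_bilin Q (tnth e i) (tnth e j).

Definition qf_rank (Q : quadratic_form) : nat := \rank (gram_mx Q).

Definition upper_index := {ij : 'I_n * 'I_n | (ij.1 <= ij.2)%N}.

(* The variable 'X_k of {mpoly F[#|{: upper_index}|]} stands for the coordinate
   b_ij, where (i, j) is the k-th pair with i <= j. *)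
Definition coord_val (Q : quadratic_form) (k : 'I_#|{: upper_index}|) : F :=
  let ij := val (enum_val k) in gram_mx Q ij.1 ij.2.

Definition zariski_closure (S : set quadratic_form) : set quadratic_form :=
  [set Q' | forall p : {mpoly F[#|{: upper_index}|]},
     (forall Q, S Q -> p.@[coord_val Q] = 0) -> p.@[coord_val Q'] = 0].

End Coordinates.

End QuadraticForms.

(* Main.v *)
(* One inclusion holds because a minor of the Gram matrix is a polynomial in the
   b_ij, and every minor of size larger than r vanishes on the orbit.
   For the other one, write the Gram matrices of Q and Q' as P^T D P and
   P'^T D' P' with P, P' invertible and D, D' diagonal, the nonzero diagonal
   entries first; if rank Q' <= r then D' = diag(y_i d_i) for some y_i.  When
   every y_i is the square of some x_i <> 0, the matrix P'^T diag(y_i d_i) P' is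
   congruent to that of Q through P^-1 diag(x_i) P'.  As F is infinite, a
   polynomial in the y_i vanishing at all nonzero squares vanishes everywhere,
   which replaces extracting square roots in the algebraic closure. *)

Require Import Defs.
From mathcomp Require Import all_boot all_order all_algebra.
From mathcomp Require Import boolp classical_sets cardinality.
From mathcomp Require Import mpoly.

Local Open Scope classical_set_scope.
Local Open Scope ring_scope.

Set Implicit Arguments.
Unset Strict Implicit.
Unset Printing Implicit Defensive.
Import GRing.Theory passmx.

(** * Polynomials vanishing at nonzero squares of an infinite field *)

Section InfiniteField.
Variable F : fieldType.
Hypothesis F_infinite : infinite_set [set: F].

Lemma poly_vanish_eq0 (q : {poly F}) : (forall x, q.[x] = 0) -> q = 0.
Proof.
move=> q0; apply: contrapT => /eqP nz_q.
have [B _ szB] := infinite_set_fset (size q) F_infinite.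
have := max_poly_roots nz_q _ (finmap.fset_uniq B).
rewrite ltnNge szB => /(_ _)/negP; apply=> //.
by apply/allP => x _; rewrite rootE q0.
Qed.

Lemma poly_sqr_vanish_eq0 (q : {poly F}) :
  (forall x, x != 0 -> q.[x ^+ 2] = 0) -> q = 0.
Proof.
(* The factor ['X] covers the excluded point 0; composing with the nonconstant ['X^2] kills no
   nonzero polynomial. *)
move=> q0; have : (q \Po 'X^2) * 'X = 0.
  apply: poly_vanish_eq0 => x; rewrite !hornerE horner_comp !hornerE.
  by have [->|/q0->] := eqVneq x 0; rewrite ?mulr0 ?mul0r.
move=> /eqP; rewrite mulf_eq0 polyX_eq0 orbF comp_poly_eq0 ?size_polyXn //.
by move/eqP.
Qed.

Lemma meval_affine_line m (p : {mpoly F[m]}) (a b : 'I_m -> F) :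
  exists q : {poly F}, forall t, q.[t] = p.@[fun k => a k + t * b k].
Proof.
exists (\sum_(u <- msupp p)
   p@_u *: \prod_i ((a i)%:P + b i *: 'X) ^+ u i) => t.
rewrite mevalE horner_sum; apply: eq_bigr => u _.
rewrite hornerZ horner_prod; congr (_ * _); apply: eq_bigr => i _.
by rewrite !hornerE [b i * t]mulrC.
Qed.

(* Coordinates are freed one at a time: along each coordinate line the
   polynomial vanishes at the infinitely many nonzero squares. *)
Lemma meval_squares_vanish n m (p : {mpoly F[m]}) (L : 'I_n -> 'I_m -> F) :
  (forall x : 'I_n -> F, (forall i, x i != 0) ->
     p.@[fun k => \sum_i x i ^+ 2 * L i k] = 0) ->
  forall y : 'I_n -> F, p.@[fun k => \sum_i y i * L i k] = 0.
Proof.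
move=> p0 y.
(* Induction invariant: the listed indices are free, the others carry nonzero squares. For the full
   list the condition is empty. *)
have: forall i, i \notin enum 'I_n -> exists2 x, x != 0 & y i = x ^+ 2.
  by move=> i; rewrite mem_enum.
elim: (enum 'I_n) y => [|j s IHs] y y_sq.
  have /choice[x xP] : forall i, exists x, x != 0 /\ y i = x ^+ 2.
    by move=> i; have [//|x] := y_sq i; exists x.
  rewrite -[RHS](p0 x) => [|i]; last by case: (xP i).
  by apply: meval_eq => k; apply: eq_bigr => i _; case: (xP i) => _ ->.
have [q qE] :=
  meval_affine_line p (fun k => \sum_(i | i != j) y i * L i k) (L j).
have E t : q.[t] = p.@[fun k => \sum_i (if i == j then t else y i) * L i k].
  rewrite qE; apply: meval_eq => k; rewrite [RHS](bigD1 j) //= eqxx addrC.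
  by congr (_ + _); apply: eq_bigr => i /negPf->.
have q0 : q = 0.
  apply: poly_sqr_vanish_eq0 => x nz_x; rewrite E IHs // => i s'i.
  case: eqVneq => [_|i'j]; first by exists x.
  by apply: y_sq; rewrite inE negb_or i'j.
rewrite -[RHS](horner0 (y j)) -q0 E; apply: meval_eq => k.
by apply: eq_bigr => i _; case: eqVneq => [->|].
Qed.

End InfiniteField.

(** * Diagonalization of symmetric matrices by congruence *)

Section SymmetricMatrices.
Variable F : fieldType.
Hypothesis F_char : 2%N \notin [pchar F].

(** A nonzero diagonal entry is the value at a basis vector. If the diagonal is zero, the sum of the
    i-th and j-th basis vectors has value [2 * M i j], and 2 is invertible. *)
Lemma sym_mx_anisotropic n (M : 'M[F]_n) : M^T = M -> M != 0 ->
  exists v : 'rV_n, (v *m M *m v^T) 0 0 != 0.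
Proof.
move=> symM nzM.
have deltaE i j :
    ((delta_mx 0 i : 'rV_n) *m M *m (delta_mx 0 j : 'rV_n)^T) 0 0 = M i j.
  by rewrite trmx_delta -rowE -colE !mxE.
have [/existsP[i Mii]|/existsPn M0] := boolP [exists i, M i i != 0].
  by exists (delta_mx 0 i); rewrite deltaE.
have [i [j nzMij]] : exists i j, M i j != 0.
  apply: contrapT => no_ij; case/eqP: nzM; apply/matrixP => i j.
  by rewrite mxE; apply: contrapT => /eqP nz; case: no_ij; exists i, j.
exists (delta_mx 0 i + delta_mx 0 j).
have addE (A B : 'M[F]_1) : (A + B) 0 0 = A 0 0 + B 0 0 by rewrite mxE.
rewrite linearD /= !(mulmxDl, mulmxDr) !addE !deltaE.
rewrite (eqP (negbNE (M0 i))) (eqP (negbNE (M0 j))) add0r addr0.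
have -> : M j i = M i j by rewrite -[in LHS]symM mxE.
by rewrite -mulr2n -mulr_natr mulf_neq0.
Qed.

(* The anisotropic vector v splits off the rank one form (v M)^T (v M) / a,
   leaving a row space that is orthogonal to v, hence smaller. *)
Lemma sym_mx_sum_squares k n (M : 'M[F]_n) : M^T = M -> (\rank M <= k)%N ->
  exists (W : 'M_(k, n)) (d : 'rV_k), M = W^T *m diag_mx d *m W.
Proof.
elim: k M => [|k IHk] M symM rkM.
  exists 0, 0; apply/eqP; rewrite mulmx0 -mxrank_eq0.
  by move: rkM; rewrite leqn0.
have [->|nzM] := eqVneq M 0; first by exists 0, 0; rewrite mulmx0.
have [v] := sym_mx_anisotropic symM nzM.
set a := (_ *m _) 0 0 => nz_a; set w := v *m M.
have wT : w^T = M *m v^T by rewrite trmx_mul symM.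
have wv : w *m v^T = a%:M by rewrite [LHS]mx11_scalar.
set M1 := M - a^-1 *: (w^T *m w).
have symM1 : M1^T = M1.
  by rewrite linearB linearZ /= trmx_mul trmxK symM.
have M1v : M1 *m v^T = 0.
  rewrite mulmxBl -scalemxAl -mulmxA wv mul_mx_scalar scalerA mulVf //.
  by rewrite scale1r wT subrr.
have ltM1 : (M1 < M)%MS.
  rewrite ltmxE; apply/andP; split.
    by rewrite addmx_sub // eqmx_opp scalemx_sub // mulmxA submxMl.
  (* Otherwise [v *m M = u *m M1], and [M1 *m v^T = 0] would give [a = 0]. *)
  apply: contra nz_a => /(submx_trans (submxMl v M)) /submxP[u wE].
  by rewrite /a wE -mulmxA M1v mulmx0 mxE.
have [|W [d M1E]] := IHk M1 symM1.
  by rewrite -ltnS (leq_trans (rank_ltmx ltM1)).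
suff ME : M = (col_mx w W)^T *m diag_mx (row_mx (a^-1)%:M d) *m col_mx w W.
  by exists (col_mx w W), (row_mx (a^-1)%:M d).
rewrite diag_mx_row tr_col_mx mul_row_block !mulmx0 addr0 add0r mul_row_col.
rewrite -M1E; have ->: diag_mx (a^-1)%:M = (a^-1)%:M :> 'M[F]_1.
  by apply/matrixP => i j; rewrite !mxE !ord1.
by rewrite mul_mx_scalar -scalemxAl addrC subrK.
Qed.

(** A sum of exactly [\rank M] weighted squares leaves no room for rank loss: the rows of [W] are
    independent and all weights are nonzero. So [W] extends to an invertible [P], and the weights
    are padded with zeros. *)
Lemma sym_mx_normal_form n (M : 'M[F]_n) : M^T = M ->
  exists (P : 'M_n) (d : 'rV_n),
  [/\ P \in unitmx, forall i, (d 0 i != 0) = (i < \rank M)%N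
    & M = P^T *m diag_mx d *m P].
Proof.
move=> symM; have [W [d ME]] := sym_mx_sum_squares symM (leqnn _).
move: d W ME; set r := \rank M => d W ME.
have le_rn : (r <= n)%N by apply: rank_leq_row.
have rkW : \rank W = r.
  by apply/eqP; rewrite eqn_leq rank_leq_row {1}/r ME mxrankM_maxr.
have nz_d i : d 0 i != 0.
  have: diag_mx d \in unitmx.
    rewrite -row_free_unit -row_leq_rank {1}/r ME.
    by rewrite (leq_trans (mxrankM_maxl _ _)) ?mxrankM_maxr.
  by rewrite unitmxE det_diag unitfE => /prodf_neq0; apply.
have pidW : (pid_mx r : 'M_(r, n)) *m (pid_mx r *m W) = W.
  by rewrite mulmxA pid_mx_id // pid_mx_1 mul1mx.
(* This yields an invertible [P] whose first [r] rows are those of [W]. *)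
have [|P unitP] :=
  @complete_unitmx _ _ _ (pid_mx r : 'M[F]_(r, n)) (pid_mx r *m W).
  by rewrite pidW rkW rank_pid_mx.
rewrite pidW => WE.
exists P, (d *m pid_mx r); split=> // [i|].
  rewrite mxE; have [lt_ir|ge_ir] := ltnP i r.
    rewrite (bigD1 (Ordinal lt_ir)) //= big1 ?addr0 => [|j ne_j].
      by rewrite mxE eqxx lt_ir mulr1 nz_d.
    by rewrite mxE -val_eqE /= in ne_j *; rewrite (negPf ne_j) mulr0.
  rewrite big1 ?eqxx // => j _; rewrite mxE.
  by rewrite ltn_eqF ?mulr0 // (leq_trans (ltn_ord j)).
rewrite [LHS]ME WE trmx_mul !mulmxA; congr (_ *m _).
rewrite -!mulmxA; congr (_ *m _).
apply/matrixP => i j; rewrite mul_diag_mx !mxE -sumrMnl; apply: eq_bigr => k _.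
rewrite !mxE -(inj_eq val_inj i j) ltn_ord !andbT.
have [->|_] := eqVneq (k : nat) i; last by rewrite mul0r mulr0 mul0rn.
by rewrite mul1r mulr1 mulr_natr.
Qed.

End SymmetricMatrices.

(** * Rank and minors *)

Lemma exists_unit_minor (F : fieldType) n (A : 'M[F]_n) :
  exists f g : 'I_(\rank A) -> 'I_n, mxsub f g A \in unitmx.
Proof.
(* First a maximal independent set of rows, then as many independent columns of the matrix they
   form. *)
have /eqP rk_rows := maxrowsub_free A.
set A1 := rowsub _ A in rk_rows.
have full_A1T : row_full A1^T by rewrite /row_full mxrank_tr rk_rows.
exists (maxrankfun A), (fullrankfun full_A1T).
rewrite -unitmx_tr -row_full_unit /row_full; apply/eqP.
rewrite -[RHS](mxrank_fullrowsub full_A1T).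
by congr (\rank _); apply/matrixP => i j; rewrite !mxE.
Qed.

Lemma mxrank_mxsub (F : fieldType) m n m' n' (f : 'I_m' -> 'I_m)
    (g : 'I_n' -> 'I_n) (A : 'M[F]_(m, n)) :
  (\rank (mxsub f g A) <= \rank A)%N.
Proof.
have -> : mxsub f g A = rowsub f 1%:M *m A *m colsub g 1%:M.
  by rewrite mulmx_colsub mulmx1 -rowsubE; apply/matrixP => i j; rewrite !mxE.
by rewrite (leq_trans (mxrankM_maxl _ _)) // mxrankM_maxr.
Qed.

(** * Gram matrices and their coordinates *)

Section GramMatrix.
Variables (F : fieldType) (V : vectType F).
Implicit Type Q : quadratic_form V.

Lemma assoc_bilinC Q u v : assoc_bilin Q u v = assoc_bilin Q v u.
Proof.
rewrite /assoc_bilin [v + u]addrC -(opprB u v) -[in RHS]scaleN1r qf_homog.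
by rewrite sqrrN expr1n mul1r.
Qed.

Lemma gram_mx_sym n (e : n.-tuple V) Q : (gram_mx e Q)^T = gram_mx e Q.
Proof. by apply/matrixP => i j; rewrite !mxE assoc_bilinC. Qed.

Lemma scalar_lincomb (f : V -> F) I (r : seq I) (c : I -> F) (u : I -> V) :
  scalar f -> f (\sum_(i <- r) c i *: u i) = \sum_(i <- r) c i * f (u i).
Proof.
move=> f_lin; elim/big_rec2: _ => [|i y x _ <-]; last exact: f_lin.
(* [f 0 = 0] because [0 = -1 *: 0 + 0]. *)
by rewrite -[X in f X]addr0 -[X in X + _]oppr0 -scaleN1r f_lin mulN1r addNr.
Qed.

Lemma coord_val_gram n (e : n.-tuple V) (i j : 'I_n) :
  exists k, forall Q, coord_val e Q k = gram_mx e Q i j.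
Proof.
wlog le_ij : i j / (i <= j)%N => [IH|].
  have [/IH //|/ltnW/IH[k kE]] := leqP i j.
  by exists k => Q; rewrite kE -[in LHS]gram_mx_sym mxE.
exists (enum_rank (Sub (i, j) le_ij : upper_index n)) => Q.
by rewrite /coord_val enum_rankK.
Qed.

(** The generic symmetric matrix: its minors are the polynomials that bound the rank on the
    closure. *)
Lemma gram_mx_mpoly n (e : n.-tuple V) :
  exists X : 'M[{mpoly F[_]}]_n,
    forall Q, map_mx (meval (coord_val e Q)) X = gram_mx e Q.
Proof.
have /choice[K KE] : forall ij : 'I_n * 'I_n,
    exists k, forall Q, coord_val e Q k = gram_mx e Q ij.1 ij.2.
  by move=> ij; apply: coord_val_gram.
exists (\matrix_(i, j) 'X_(K (i, j))) => Q; apply/matrixP => i j.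
by rewrite mxE mxE mevalXU KE.
Qed.

(** * The action in a basis and the two inclusions *)

Section Basis.
Variable e : (\dim {:V}).-tuple V.
Hypothesis e_basis : basis_of fullv e.

(** Row i of [mxof e e g] holds the coordinates of the image of the i-th basis vector, which puts
    the transpose on the right. *)
Lemma gram_mx_act Q (g : 'End(V)) :
  gram_mx e (qf_act Q g) = mxof e e g *m gram_mx e Q *m (mxof e e g)^T.
Proof.
have gE i : g (tnth e i) = \sum_j mxof e e g i j *: tnth e j.
  rewrite (tnth_nth 0) -vecof_delta (hom_vecof e e_basis) -rowE /vecof.
  by apply: eq_bigr => j _; rewrite mxE (tnth_nth 0).
have [Bl Br] := qf_bilin Q.
apply/matrixP => i j.
have -> : gram_mx e (qf_act Q g) i j
        = assoc_bilin Q (g (tnth e i)) (g (tnth e j)).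
  by rewrite mxE /assoc_bilin /= linearD linearB.
rewrite [g (tnth e j)]gE scalar_lincomb; last exact: Br.
move: (mxof e e g) gE => G gE; rewrite [RHS]mxE.
apply: eq_bigr => l _; rewrite gE (scalar_lincomb _ _ _ (Bl _)).
by rewrite !mxE mulrC; congr (_ * _); apply: eq_bigr => k _; rewrite mxE.
Qed.

Lemma hommx_GL (G : 'M[F]_(\dim {:V})) :
  G \in unitmx -> GL (hommx e e G).
Proof.
move=> unitG; exists (hommx e e (invmx G)) => u.
  by rewrite -comp_lfunE -hommx_mul // mulmxV // hommx1 // id_lfunE.
by rewrite -comp_lfunE -hommx_mul // mulVmx // hommx1 // id_lfunE.
Qed.

Lemma qf_rank_zariski_closure (Q Q' : quadratic_form V) :
  zariski_closure e (orbit_GL Q) Q' -> (qf_rank e Q' <= qf_rank e Q)%N.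
Proof.
move=> clQ'; rewrite leqNgt; apply/negP => ltQQ'.
have [X XE] := gram_mx_mpoly e.
have [f [g]] := exists_unit_minor (gram_mx e Q').
have minorE P : (\det (mxsub f g X)).@[coord_val e P]
             = \det (mxsub f g (gram_mx e P)).
  by rewrite -det_map_mx map_mxsub XE.
(* The test polynomial is this minor of [X]: nonzero at [Q'], but larger than the rank of every form
   in the orbit. *)
rewrite unitmxE unitfE -minorE => /eqP; apply; apply: clQ' => _ [h _ <-].
rewrite minorE; apply/eqP; rewrite -[_ == 0]negbK -unitfE -unitmxE.
rewrite -row_free_unit -row_leq_rank -ltnNge.
apply: leq_ltn_trans (mxrank_mxsub _ _ _) _; rewrite gram_mx_act.
apply: leq_ltn_trans ltQQ'.
by rewrite (leq_trans (mxrankM_maxl _ _)) ?mxrankM_maxr.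
Qed.

Lemma mem_zariski_closure_orbit (Q Q' : quadratic_form V) :
  infinite_set [set: F] -> 2%N \notin [pchar F] ->
  (qf_rank e Q' <= qf_rank e Q)%N -> zariski_closure e (orbit_GL Q) Q'.
Proof.
move=> F_infinite F_char leQ'Q p p0.
have [P [d [unitP d_neq0 QE]]] := sym_mx_normal_form F_char (gram_mx_sym e Q).
have [P' [d' [unitP' d'_neq0 Q'E]]] :=
  sym_mx_normal_form F_char (gram_mx_sym e Q').
have congE (c : 'rV_(\dim {:V})) i j :
    (P'^T *m diag_mx c *m P') i j = \sum_k c 0 k * (P' k i * P' k j).
  rewrite mxE; apply: eq_bigr => k _.
  by rewrite mul_mx_diag !mxE mulrCA mulrA.
(* [L i] lists the coordinates of [d 0 i] times the square of the linear form given by row i of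
   [P']. *)
pose L i (k : 'I_#|{: upper_index (\dim {:V})}|) :=
  let ij := val (enum_val k) in d 0 i * (P' i ij.1 * P' i ij.2).
have Lp0 (x : 'I_(\dim {:V}) -> F) : (forall i, x i != 0) ->
    p.@[fun k => \sum_i x i ^+ 2 * L i k] = 0.
  move=> nz_x; pose D := diag_mx (\row_i x i).
  pose G := (invmx P *m D *m P')^T.
  have unitG : G \in unitmx.
    rewrite unitmx_tr !unitmx_mul unitmx_inv unitP unitP' andbT /=.
    rewrite unitmxE det_diag unitfE; apply/prodf_neq0 => i _.
    by rewrite mxE.
  rewrite -[RHS](p0 (qf_act Q (hommx e e G))); last first.
    by exists (hommx e e G) => //; apply: hommx_GL.
  apply: meval_eq => k; rewrite /coord_val gram_mx_act hommxK // QE trmxK.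
  have -> : G *m (P^T *m diag_mx d *m P) *m (invmx P *m D *m P')
     = P'^T *m diag_mx (\row_i (x i ^+ 2 * d 0 i)) *m P'.
    rewrite /G !trmx_mul tr_diag_mx trmx_inv !mulmxA mulmxKV ?unitmx_tr //.
    rewrite mulmxK // -[_ *m D *m diag_mx d]mulmxA -[_ *m _ *m D]mulmxA.
    rewrite !mulmx_diag; congr (_ *m diag_mx _ *m _).
    by apply/rowP => i; rewrite !mxE mulrAC.
  by rewrite congE; apply: eq_bigr => i _; rewrite mxE; apply: mulrA.
(* These ratios turn the [L i] into the coordinates of [Q']. Where [d 0 i = 0], the index is beyond
   the rank of [Q], hence of [Q'], so [d' 0 i = 0] as well. *)
rewrite -[RHS](meval_squares_vanish F_infinite Lp0 (fun i => d' 0 i / d 0 i)).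
apply: meval_eq => k; rewrite /coord_val Q'E congE; apply: eq_bigr => i _.
rewrite /L [RHS]mulrA; congr (_ * _); have [d0|nz_d] := eqVneq (d 0 i) 0.
  rewrite d0 mulr0; apply/eqP; rewrite -[_ == 0]negbK d'_neq0 -leqNgt.
  by rewrite (leq_trans leQ'Q) // leqNgt -d_neq0 d0 eqxx.
by rewrite divfK.
Qed.

End Basis.
End GramMatrix.

Theorem theorem1 (F : fieldType) (F_infinite : infinite_set [set: F])
    (F_char : 2%N \notin [pchar F]) (V : vectType F)
    (n : nat) (e : n.-tuple V) (e_basis : basis_of fullv e)
    (Q : quadratic_form V) (r : nat) (Q_rank : qf_rank e Q = r) :
  zariski_closure e (orbit_GL Q) =
  [set Q' : quadratic_form V | (qf_rank e Q' <= r)%N].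
Proof.
have dimV : n = \dim {:V}.
  by rewrite -(span_basis e_basis) (eqnP (basis_free e_basis)) size_tuple.
subst n r.
apply/seteqP; split=> Q' /=; first exact: qf_rank_zariski_closure.
exact: mem_zariski_closure_orbit.
Qed.
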